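(* Let $n$ be a positive integer, let $X_1,\dots,X_n$ be metrizable topological spaces, let $X=X_1\times\dots\times X_n$ with the product topology, and let $E\subseteq X$. Then there exists a separately continuous function $f:X\to\mathbb{R}$ with $D(f)=E$ if and only if there exists a sequence $(E_m)_{m=1}^{\infty}$ of subsets of $X$ such that $E=\bigcup_{m=1}^{\infty}E_m$ and each $E_m$ is an $F_\sigma$-set in $X$ which is locally projectively meagre.
   Context: For a function $f:X\to\mathbb{R}$ on a topological space $X$, $D(f)$ denotes the set of all points of $X$ at which $f$ is discontinuous. A function $f:X_1\times\dots\times X_n\to\mathbb{R}$ is separately continuous if it is continuous with respect to each variable, i.e. for each $k$, fixing all coordinates other than the $k$-th one arbitrarily gives a continuous function on $X_k$. For $X=X_1\times\dots\times X_n$ and $k\in\{1,\dots,n\}$ put $\hat X_k=X_1\times\dots\times X_{k-1}\times X_{k+1}\times\dots\times X_n$ (product topology; the empty product is a one-point space), and let $p_{\hat X_k}:X\to\hat X_k$ be the map $(x_1,\dots,x_n)\mapsto(x_1,\dots,x_{k-1},x_{k+1},\dots,x_n)$ that omits the $k$-th coordinate. A set $A\subseteq X$ is projectively meagre with respect to the $k$-th variable if $p_{\hat X_k}(A)$ is meagre (a countable union of nowhere dense sets) in $\hat X_k$. It is locally projectively meagre with respect to the $k$-th variable if every $x\in X$ has a neighborhood $U$ in $X$ such that $A\cap U$ is projectively meagre with respect to the $k$-th variable. It is locally projectively meagre if it is locally projectively meagre with respect to the $k$-th variable for every $k=1,\dots,n$. An $F_\sigma$-set is a countable union of closed sets. 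*)

(* Defs.v *)
From mathcomp Require Import all_boot all_order all_algebra.
From mathcomp Require Import all_classical all_reals all_analysis.

Set Implicit Arguments.
Unset Strict Implicit.
Unset Printing Implicit Defensive.

Import Order.TTheory GRing.Theory Num.Theory.
Import numFieldNormedType.Exports.

Local Open Scope classical_set_scope.
Local Open Scope ring_scope.

(* [nbhs_ball_ B x] is the neighborhood filter of [x] generated by the balls
   [B x e], [0 < e]; the last clause thus says that [d] induces the given
   topology of [T]. *)
Definition metrizable (R : realType) (T : topologicalType) : Prop :=
  exists d : T -> T -> R,
    [/\ forall x y, d x y = 0 <-> x = y,
        forall x y, d x y = d y x,
        forall x y z, d x z <= d x y + d y z
      & forall x : T, nbhs x = nbhs_ball_ (fun y e => [set z | d y z < e]) x].

Definition nowhere_dense (T : topologicalType) (A : set T) : Prop :=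
  interior (closure A) = set0.

Definition meagre (T : topologicalType) (A : set T) : Prop :=
  exists2 F : (set T)^nat,
    (forall i, nowhere_dense (F i)) & A = \bigcup_i F i.

Definition discontinuity_set (T : topologicalType) (R : realType)
  (f : T -> R) : set T := [set x | ~ {for x, continuous f}].

(* [dfwith x k t] is the point [x] with its [k]-th coordinate replaced by [t]. *)
Definition separately_continuous (R : realType) (n : nat)
    (X : 'I_n -> topologicalType) (f : prod_topology X -> R) : Prop :=
  forall (k : 'I_n) (x : prod_topology X),
    continuous (fun t : X k => f (dfwith x k t)).

(* [lift k] is the increasing enumeration of the indices other than [k], so
   this is the product of all the factors but the [k]-th. *)
Definition omit_prod (n : nat) (X : 'I_n -> topologicalType) (k : 'I_n) :
    topologicalType :=
  prod_topology (fun j : 'I_n.-1 => X (lift k j)).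

Definition omit_coord (n : nat) (X : 'I_n -> topologicalType) (k : 'I_n)
    (x : prod_topology X) : omit_prod X k :=
  fun j => x (lift k j).

Definition projectively_meagre (n : nat) (X : 'I_n -> topologicalType)
    (k : 'I_n) (A : set (prod_topology X)) : Prop :=
  meagre (omit_coord k @` A).

Definition locally_projectively_meagre_wrt (n : nat)
    (X : 'I_n -> topologicalType) (k : 'I_n) (A : set (prod_topology X)) :
    Prop :=
  forall x : prod_topology X,
    exists2 U : set (prod_topology X),
      nbhs x U & projectively_meagre k (A `&` U).

Definition locally_projectively_meagre (n : nat)
    (X : 'I_n -> topologicalType) (A : set (prod_topology X)) : Prop :=
  forall k : 'I_n, locally_projectively_meagre_wrt k A.

(* Main.v *)
(* A point of discontinuity with oscillation at least [e] lies in a product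
   [U x N], where [U] belongs to a sigma-discrete base of the [k]-th factor and
   [N] consists of the [y] for which the slices [f (-, y)] vary by at most [e / 7]
   on [U] although [f] oscillates by [e] at some point over [U].  Kempisty's
   quasicontinuity and Banach's category theorem show that [N] is meagre, by
   induction on the number of factors; discreteness of the base then turns these
   products into countably many closed, locally projectively meagre sets.

   Conversely, a closed locally projectively meagre set is a countable union of
   closed sets [E], each lying in a closed nowhere dense set [L] that contains,
   near every point of [E], the lines through that point parallel to the axes.
   A set [Z] outside [L], discrete off [E] and accumulating at every point of
   [E], gives the function [d(x, L) / (d(x, L) + d(x, Z))], which is continuous
   off [E], vanishes on [L] and is [1] on [Z].  Such functions are nonnegative and
   vanish on their discontinuity sets, hence are lower semicontinuous, so that
   no cancellation occurs in a weighted sum of them. *)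

Require Import Defs.
From mathcomp Require Import all_boot all_order all_algebra.
From mathcomp Require Import all_classical all_reals all_analysis.
From mathcomp Require Import borel_hierarchy wochoice lra.

Set Implicit Arguments.
Unset Strict Implicit.
Unset Printing Implicit Defensive.

Import Order.TTheory GRing.Theory Num.Theory.
Import numFieldNormedType.Exports.

Local Open Scope classical_set_scope.
Local Open Scope ring_scope.

(** * Discrete families and meagre sets *)

Section Discrete.
Variables (T : topologicalType) (I : Type).
Implicit Types F G : I -> set T.

(** Usual discreteness, every point having a neighbourhood that meets at most one member, with the
    index [c] of that member named; [c] is arbitrary when none is met. *)
Definition discrete_family F :=
  forall x : T, exists c, \forall z \near x, forall c', F c' z -> c' = c.

Lemma discrete_family_sub F G : (forall c, G c `<=` F c) ->
  discrete_family F -> discrete_family G.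
Proof.
move=> GF dF x; have [c xc] := dF x; exists c.
by apply: filterS xc => z zc c' /GF/zc.
Qed.

Lemma discrete_family_closure F :
  discrete_family F -> discrete_family (fun c => closure (F c)).
Proof.
move=> dF x; have [c /nbhs_interior xc] := dF x; exists c.
by apply: filterS xc => z zc c' /(_ _ zc)[y [Fy]]; exact.
Qed.

Lemma closure_discrete F : discrete_family F ->
  closure (\bigcup_c F c) `<=` \bigcup_c closure (F c).
Proof.
move=> dF x Fx; have [c xc] := dF x; exists c => // B xB.
have [z [[c' _ Fz] [Bz zc]]] := Fx _ (filterI xB xc).
by exists z; split=> //; rewrite -(zc _ Fz).
Qed.

Lemma closed_discrete F : discrete_family F ->
  (forall c, closed (F c)) -> closed (\bigcup_c F c).
Proof.
move=> dF cF x /(closure_discrete dF)[c _ Fx].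
by exists c => //; exact: cF.
Qed.

Lemma nowhere_dense_discrete F : discrete_family F ->
  (forall c, nowhere_dense (F c)) -> nowhere_dense (\bigcup_c F c).
Proof.
move=> dF nF; rewrite /nowhere_dense -subset0 => x xF.
have [c xc] := discrete_family_closure dF x.
rewrite -(nF c); apply: filterS2 xF xc => z /(closure_discrete dF)[c' _ Fz].
by move=> /(_ _ Fz) <-.
Qed.

End Discrete.

Lemma discrete_family_preimage (S T : topologicalType) (I : Type) (p : S -> T)
  (F : I -> set T) : continuous p -> discrete_family F ->
  discrete_family (fun c => p @^-1` F c).
Proof.
by move=> cp dF x; have [c xc] := dF (p x); exists c; exact: cp xc.
Qed.

Section Meagre.
Variable T : topologicalType.
Implicit Types A B : set T.

Lemma nowhere_dense_sub A B : A `<=` B -> nowhere_dense B -> nowhere_dense A.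
Proof.
rewrite /nowhere_dense -!subset0 => AB B0; apply: subset_trans B0.
exact/interiorS/closureS.
Qed.

Lemma nowhere_dense_closure A : nowhere_dense A -> nowhere_dense (closure A).
Proof.
move=> nA; rewrite /nowhere_dense -(closure_id (closure A)).1//.
exact: closed_closure.
Qed.

Lemma nowhere_dense0 : nowhere_dense (set0 : set T).
Proof. by rewrite /nowhere_dense closure0 interior0. Qed.

Lemma nowhere_dense_frontier A : closed A -> nowhere_dense (A `\` interior A).
Proof.
move=> cA; have cAi : closed (A `\` interior A).
  by apply: closedI => //; apply: open_closedC; exact: open_interior.
rewrite /nowhere_dense -(closure_id _).1// -subset0 => x xA.
have [_ []] := nbhs_singleton xA.
by apply: filterS xA => z [].
Qed.

Lemma closed_nowhere_dense_setU A B : closed A -> nowhere_dense A ->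
  nowhere_dense B -> nowhere_dense (A `|` B).
Proof.
move=> cA nA nB; rewrite /nowhere_dense closureU -(closure_id _).1//.
rewrite -subset0 => x /nbhs_interior xAB; rewrite -nB.
(* Where a neighbourhood misses [closure B], the union reduces to [A], whose interior is empty. *)
have sAB : (A `|` closure B)^° `<=` closure B.
  move=> y yAB; apply: closed_closure => V yV; apply: contrapT => nBV.
  suff : A^° y by rewrite {1}(closure_id A).1// nA.
  apply: filterS2 yAB yV => z [//|Bz Vz]; exfalso; apply: nBV.
  by exists z.
exact: filterS sAB xAB.
Qed.

Lemma meagre_cover A (F : (set T)^nat) : (forall i, nowhere_dense (F i)) ->
  A `<=` \bigcup_i F i -> meagre A.
Proof.
move=> nF AF; exists (fun i => A `&` F i).
  by move=> i; apply: nowhere_dense_sub (nF i) => x [].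
by rewrite -setI_bigcupr; apply/esym/setIidl.
Qed.

Lemma nowhere_dense_meagre A : nowhere_dense A -> meagre A.
Proof. by move=> nA; apply: (@meagre_cover _ (fun=> A)) => // x; exists 0%N. Qed.

Lemma meagre_sub A B : A `<=` B -> meagre B -> meagre A.
Proof. by move=> AB [F nF BF]; apply: (meagre_cover nF); rewrite -BF. Qed.

Lemma meagre_countable (I : countType) A (F : I -> set T) :
  (forall i, meagre (F i)) -> A `<=` \bigcup_i F i -> meagre A.
Proof.
move=> mF AF; have /choice[G GP] : forall i, exists Gi : (set T)^nat,
    (forall j, nowhere_dense (Gi j)) /\ F i = \bigcup_j Gi j.
  by move=> i; have [Gi] := mF i; exists Gi.
apply: (@meagre_cover _ (fun k =>
  if @unpickle (I * nat)%type k is Some ij then G ij.1 ij.2 else set0)).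
  move=> k; case: unpickle => [ij|]; first by have [] := GP ij.1.
  exact: nowhere_dense0.
move=> x /AF[i _]; rewrite (GP i).2 => -[j _ Gx].
by exists (pickle (i, j)) => //; rewrite pickleK.
Qed.

Lemma meagreU A B : meagre A -> meagre B -> meagre (A `|` B).
Proof.
move=> mA mB; apply: (@meagre_countable bool _ (fun b => if b then A else B)).
  by case.
by move=> x [Ax|Bx]; [exists true|exists false].
Qed.

(** The index type may be uncountable: for fixed [j], the [j]-th nowhere dense parts of all members
    again form a discrete family, so their union is nowhere dense. *)
Lemma meagre_discrete (I : Type) (F : I -> set T) : discrete_family F ->
  (forall c, meagre (F c)) -> meagre (\bigcup_c F c).
Proof.
move=> dF mF; have /choice[G GP] : forall c, exists Gc : (set T)^nat,
    (forall j, nowhere_dense (Gc j)) /\ F c = \bigcup_j Gc j.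
  by move=> c; have [Gc] := mF c; exists Gc.
apply: (@meagre_cover _ (fun j => \bigcup_c G c j)).
  move=> j; apply: nowhere_dense_discrete; last by move=> c; apply: (GP c).1.
  by apply: discrete_family_sub dF => c; rewrite (GP c).2; exact: bigcup_sup.
by move=> x [c _]; rewrite (GP c).2 => -[j _ Gx]; exists j => //; exists c.
Qed.

End Meagre.

Lemma metrizableP (R : realType) (T : topologicalType) : metrizable R T ->
  exists d : T -> T -> R,
    [/\ forall x y, 0 <= d x y, forall x, d x x = 0,
        forall x y, d x y = d y x,
        forall x y z, d x z <= d x y + d y z &
        (forall x y, d x y = 0 -> x = y) /\
        forall x (A : set T), nbhs x A <->
          exists2 e, 0 < e & forall z, d x z < e -> A z].
Proof.
move=> [d [d0 dC dD dn]]; exists d; split=> //.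
- move=> x y; have := dD x y x; rewrite (dC y x) (d0 x x).2//; lra.
- by move=> x; apply/d0.
- split=> [x y /d0//|x A]; rewrite dn; split=> -[e]; exists e => //.
Qed.

(** * Stone's sigma-discrete base and Banach's category theorem *)

Section SigmaDiscrete.
Variables (R : realType) (T : topologicalType).
Hypothesis T_metrizable : metrizable R T.

(* Stone's construction: the centers are well-ordered, and the part of the
   [c]-th ball of radius [1 / (j + 1)] lying in no earlier ball is shrunk by
   [1 / (m + 1)] so that the pieces become uniformly separated. *)
Lemma sigma_discrete_base :
  exists S W : nat * nat -> T -> set T,
    [/\ forall q c, closed (S q c), forall q c, open (W q c),
        forall q c, S q c `<=` W q c, forall q, discrete_family (W q) &
        forall x U, nbhs x U -> exists q c, S q c x /\ W q c `<=` U].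
Proof.
have [d [d_ge0 dxx dC dD [_ dn]]] := metrizableP T_metrizable.
have [le le_wo] := @well_ordering_principle {classic T}.
have [r [r_gt0 r_small]] : exists r : nat -> R, (forall j, 0 < r j) /\
    forall e, 0 < e -> exists j, r j < e.
  exists (fun j => j.+1%:R^-1); split=> [j|e e0]; first by rewrite invr_gt0.
  have [j _ /(_ _ (leqnn j))] := near_infty_natSinv_lt (PosNum e0).
  by exists j.
have le_min (P : set T) : P !=set0 -> exists c,
    [/\ P c, forall y, P y -> le c y &
     forall c', P c' -> (forall y, P y -> le c' y) -> c' = c].
  move=> [x Px]; pose Q : {pred {classic T}} := [pred c | `[< P c >]].
  have [|c [[/asboolP Pc c_min] c_uniq]] := le_wo Q; first by exists x; apply/asboolP.
  exists c; split=> // [y Py|c' Pc' c'_min]; first by apply: c_min; apply/asboolP.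
  by apply/esym/c_uniq; split; [apply/asboolP|move=> y /asboolP/c'_min].
(* The order laws are read off from the unique least elements of singletons and pairs. *)
have le_refl x : le x x.
  by have [|c [-> + _]] := le_min [set x]; [exists x|exact].
have le_anti x y : le x y -> le y x -> x = y.
  move=> xy yx; have [|c [_ _ cP]] := le_min [set x; y]; first by exists x; left.
  have -> : x = c by apply: cP => [|z []->//]; left.
  by apply/esym; apply: cP => [|z []->//]; right.
have le_total x y : le x y || le y x.
  have [|c [[]-> cP _]] := le_min [set x; y]; first by exists x; left.
    by rewrite cP//; right.
  by rewrite orbC cP//; left.
(* A ball about [y] fits into the ball of [c], and [y] avoids the balls of earlier centers; so
   points of different centers are at least [r q.2] apart. *)
pose S0 (q : nat * nat) c := [set y | (forall z, d y z < r q.2 -> d c z < r q.1)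
  /\ forall c', le c' c -> c' <> c -> ~ d c' y < r q.1].
pose W (q : nat * nat) c := [set x | exists2 y, S0 q c y & d y x < r q.2 / 4].
have S0sep q c c' y y' : S0 q c y -> S0 q c' y' -> d y y' < r q.2 -> c = c'.
  move=> [yc ycP] [y'c y'cP] yy'; apply: contrapT => cc'.
  have /orP[le_c|le_c] := le_total c c'.
    by apply: (y'cP c) => //; exact: yc.
  apply: (ycP c') => //; first by move=> e; exact: cc'.
  by apply: y'c; rewrite dC.
exists (fun q c => closure (S0 q c)), W; split.
- by move=> q c; exact: closed_closure.
- move=> q c; rewrite openE => x [y yS xy]; apply/dn.
  exists (r q.2 / 4 - d y x); first by lra.
  by move=> z xz; exists y => //; have := dD y x z; lra.
- move=> q c x xS; have r4 : 0 < r q.2 / 4 by rewrite divr_gt0.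
  have [|y [yS xy]] := xS [set z | d x z < r q.2 / 4]; first by apply/dn; exists (r q.2 / 4).
  by exists y => //; rewrite dC.
(* Two members met within an eighth of [x] would come from points closer than 1/4 + 1/8 + 1/8 + 1/4
   = 3/4 of the separation. *)
- move=> q x; have r8 : 0 < r q.2 / 8 by rewrite divr_gt0.
  have [[c [z [y yS yz] xz]]|nW] :=
      pselect (exists c, exists2 z, W q c z & d x z < r q.2 / 8).
    exists c; apply/dn; exists (r q.2 / 8) => // z' xz' c' [y' y'S y'z'].
    apply: (S0sep q c' c y' y) => //.
    have := dD y' z' y; have := dD z' x y; have := dD x z y.
    by rewrite (dC z y) (dC z' x); lra.
  exists x; apply/dn; exists (r q.2 / 8) => // z xz c' Wz.
  by exfalso; apply: nW; exists c', z.
(* A ball of radius [r j] containing [x] stays within [e] of [x]; [c] is the first center whose ball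
   contains [x], and [r m] fits into the room left around [x]. *)
- move=> x U /dn[e e0 eU]; have [|j rj] := r_small (e / 2); first by lra.
  have [|c [cx c_min _]] := le_min [set c | d c x < r j].
    by exists x; rewrite /= dxx.
  have [|m rm] := r_small (r j - d c x); first by rewrite subr_gt0.
  have cW : S0 (j, m) c x.
    split=> [z xz/=|c' c'c nc' c'x]; first by have /= := dD c x z; lra.
    by apply/nc'/le_anti => //; exact: c_min.
  exists (j, m), c; split; first exact: subset_closure.
  move=> z [y [yc _] /= yz]; apply: eU.
  have cz : d c z < r j by apply: yc; have := r_gt0 m; move: yz => /=; lra.
  by move: cx; have := dD x c z; rewrite (dC x c) /=; lra.
Qed.

(** Basic sets with meagre trace on [A] cover [A] within [O]; for each of the countably many [q]
    they form a discrete family, so their traces have a meagre union. *)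
Lemma meagre_local (A O : set T) :
  (forall x, O x -> exists2 V, nbhs x V & meagre (A `&` V)) ->
  meagre (A `&` O).
Proof.
move=> AO; have [S [W [_ _ SW dW base]]] := sigma_discrete_base.
(* The meagreness clause empties the members whose trace is not meagre. *)
pose F q := \bigcup_c [set x | [/\ meagre (A `&` W q c), A x & W q c x]].
apply: (@meagre_countable _ _ _ F).
  move=> q; apply: meagre_discrete; first by apply: discrete_family_sub (dW q) => c x [].
  move=> c; have [mA|nmA] := pselect (meagre (A `&` W q c)).
    by apply: meagre_sub mA => x [].
  by apply: meagre_sub (nowhere_dense_meagre (@nowhere_dense0 T)) => x [].
move=> x [Ax /AO[V /base[q [c [Sx WV]]] mV]]; exists q => //; exists c => //.
by split=> //; [apply: meagre_sub mV; exact: setIS|exact: SW].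
Qed.

(* Banach's category theorem, in the form: off some open set [G] the set [A]
   is meagre, and [A] is nowhere meagre in [G]. *)
Lemma meagre_kernel (A : set T) : exists G : set T, [/\ open G,
  meagre (A `\` G) &
  forall V, open V -> V `&` G !=set0 -> ~ meagre (A `&` V)].
Proof.
pose O : set T := [set x : T | exists2 V, nbhs x V & meagre (A `&` V)].
(* [A] is locally meagre on [O]; what it leaves outside both [O] and the interior of [C] lies in the
   nowhere dense frontier of [C]. *)
pose C := closure (A `\` O).
exists (interior C); split; first exact: open_interior.
  have mO : meagre (A `&` O) by exact: meagre_local.
  have := nowhere_dense_frontier (@closed_closure _ (A `\` O)).
  move=> /nowhere_dense_meagre/(meagreU mO); apply: meagre_sub => x [Ax nx].
  have [Ox|nOx] := pselect (O x); [by left|right].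
  by split=> //; apply: subset_closure.
move=> V oV [x [Vx Cx]] mV; have [z [[_ nOz] Vz]] := nbhs_singleton Cx _ (open_nbhs_nbhs (conj oV Vx)).
by apply: nOz; exists V => //; exact: open_nbhs_nbhs.
Qed.

End SigmaDiscrete.

(** * Finite products *)

Section FiniteProduct.
Variables (n : nat) (X : 'I_n -> topologicalType).

Lemma component_continuous (i : 'I_n) : continuous (fun x : prod_topology X => x i).
Proof. exact: proj_continuous. Qed.

Lemma nbhs_prodP (x : prod_topology X) (U : set (prod_topology X)) : nbhs x U <->
  exists2 V : forall i, set (X i), (forall i, nbhs (x i) (V i)) &
    forall y, (forall i, V i (y i)) -> U y.
Proof.
split=> [xU|[V xV VU]]; last first.
  have : \forall y \near x, forall i, V i (y i).
    apply: (@filter_forall _ _ (fun i => [set y : prod_topology X | V i (y i)])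
      (nbhs x)) => i.
    exact: component_continuous (xV i).
  exact: (filterS VU).
(* The supersets of boxes form a filter; since the product topology is a supremum, convergence to
   [x] is checked one factor at a time. *)
pose F : set_system (prod_topology X) := [set U |
  exists2 V : forall i, set (X i), (forall i, nbhs (x i) (V i)) &
    forall y, (forall i, V i (y i)) -> U y].
have FF : Filter F.
  split.
  - by exists (fun=> setT) => // i; exact: filterT.
  - move=> A B [V xV VA] [W xW WB]; exists (fun i => V i `&` W i).
      by move=> i; exact: filterI.
    by move=> y VWy; split; [apply: VA|apply: WB] => i; have [] := VWy i.
  - by move=> A B AB [V xV VA]; exists V => // y /VA/AB.
suff : F --> x by exact.
apply/cvg_sup => i A /= [B [[C oC <-] Cx] BA].
exists (fun j => if j == i then [set t | forall e : j = i, C (ecast k (X k) e t)]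
  else setT).
  move=> j; case: eqP => [ji|_]; last exact: filterT.
  rewrite ji; apply: filterS (open_nbhs_nbhs (conj oC Cx)) => z Cz e.
  by rewrite eq_axiomK.
by move=> y /(_ i); rewrite eqxx => /(_ erefl) Cy; apply: BA.
Qed.

Lemma continuous_prodP (Y : topologicalType) (g : Y -> prod_topology X) :
  (forall i : 'I_n, continuous (fun u : Y => g u i)) -> continuous g.
Proof.
move=> cg y U /nbhs_prodP[V gV VU].
have : \forall z \near y, forall i, V i (g z i).
  apply: (@filter_forall _ _ (fun i => [set z | V i (g z i)]) (nbhs y)) => i.
  exact: cg (gV i).
by apply: filterS => z /VU.
Qed.

Lemma metrizable_prod (R : realType) : (forall i, metrizable R (X i)) ->
  metrizable R (prod_topology X).
Proof.
move=> mX; have [d dP] : exists d : forall i, X i -> X i -> R, forall i,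
    [/\ forall x y, 0 <= d i x y, forall x, d i x x = 0,
        forall x y, d i x y = d i y x,
        forall x y z, d i x z <= d i x y + d i y z &
        (forall x y, d i x y = 0 -> x = y) /\
        forall x (A : set (X i)), nbhs x A <->
          exists2 e, 0 < e & forall z, d i x z < e -> A z].
  have dP i := cid (metrizableP (mX i)).
  by exists (fun i => projT1 (dP i)) => i; exact: projT2 (dP i).
have d_ge0 i (x y : X i) : 0 <= d i x y by have [] := dP i.
pose D (x y : prod_topology X) := \sum_i d i (x i) (y i).
have dD i x y : d i (x i) (y i) <= D x y.
  by rewrite /D (bigD1 i)//= lerDl sumr_ge0.
exists D; split.
- move=> x y; split=> [xy|->]; last first.
    by rewrite /D big1// => i _; have [] := dP i.
  apply: functional_extensionality_dep => i; have [_ _ _ _ [+ _]] := dP i; apply.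
  by apply/eqP; rewrite eq_le d_ge0 -xy dD.
- by move=> x y; apply: eq_bigr => i _; have [] := dP i.
- move=> x y z; rewrite /D -big_split/=; apply: ler_sum => i _.
  by have [] := dP i.
- move=> x; rewrite eqEsubset; split=> U.
    move=> /nbhs_prodP[V xV VU].
    have /choice[e eP] : forall i, exists e : R, 0 < e /\
        forall z, d i (x i) z < e -> V i z.
      move=> i; have [_ _ _ _ [_ dn]] := dP i.
      by have /dn[e e0 eV] := xV i; exists e.
    (* The initial value 1 keeps the radius positive even for an empty product. *)
    exists (\big[Num.min/1]_i e i).
      by apply: lt_bigmin => // i _; have [] := eP i.
    move=> z /= xz; apply: VU => i; apply: (eP i).2; apply: le_lt_trans (dD _ _ _) _.
    by apply: lt_le_trans xz _; exact: bigmin_le.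
  move=> [e /= e0 eU]; apply/nbhs_prodP.
  (* With [n] summands, the denominator [n.+1] makes the total strictly less than [e], also when [n]
     is 0. *)
  exists (fun i => [set z | d i (x i) z < e / n.+1%:R]).
    move=> i; have [_ _ _ _ [_ dn]] := dP i; apply/dn.
    by exists (e / n.+1%:R) => //; rewrite divr_gt0.
  move=> y Vy; apply: eU; rewrite /= /D.
  apply: (@le_lt_trans _ _ (\sum_(i < n) e / n.+1%:R)).
    by apply: ler_sum => i _; exact/ltW/Vy.
  rewrite sumr_const card_ord -mulrnAl -mulr_natr -mulrA gtr_pMr//.
  by rewrite ltr_pdivrMr// mul1r ltr_nat.
Qed.

End FiniteProduct.

(** * Inserting and omitting a coordinate *)

Section Insertion.
Variables (n : nat) (X : 'I_n -> topologicalType) (k : 'I_n).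

(** The factors form a dependent family, so values are transported along [i = lift k j] or [i = k];
    [eq_axiomK] later removes the casts. *)
Definition insert_coord (t : X k) (y : omit_prod X k) : prod_topology X :=
  fun i => match unliftP k i with
  | UnliftSome j e => ecast i (X i) (esym e) (y j)
  | UnliftNone e => ecast i (X i) (esym e) t
  end.

Lemma insert_coord_at t y : insert_coord t y k = t.
Proof.
rewrite /insert_coord; case: unliftP => [j e|e].
  by exfalso; move: (neq_lift k j); rewrite -e eqxx.
by rewrite eq_axiomK.
Qed.

Lemma insert_coord_lift t y j : insert_coord t y (lift k j) = y j.
Proof.
rewrite /insert_coord; case: unliftP => [i e|e]; last first.
  by exfalso; move: (neq_lift k j); rewrite e eqxx.
have ij := lift_inj e; rewrite -ij in e *.
by rewrite eq_axiomK.
Qed.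

Lemma prod_eqP (x y : prod_topology X) :
  x k = y k -> omit_coord k x = omit_coord k y -> x = y.
Proof.
move=> xyk xy; apply: functional_extensionality_dep => i.
by case: (unliftP k i) => [j|] ->//; exact: (congr1 (fun f => f j) xy).
Qed.

Lemma omit_insert t y : omit_coord k (insert_coord t y) = y.
Proof.
by apply: functional_extensionality_dep => j; exact: insert_coord_lift.
Qed.

Lemma omit_dfwith t (x : prod_topology X) :
  omit_coord k (dfwith x k t) = omit_coord k x.
Proof.
apply: functional_extensionality_dep => j; rewrite /omit_coord dfwithout//.
exact: neq_lift.
Qed.

Lemma insert_omit t (x : prod_topology X) :
  insert_coord t (omit_coord k x) = dfwith x k t.
Proof.
apply: prod_eqP; first by rewrite insert_coord_at dfwithin.
by rewrite omit_insert omit_dfwith.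
Qed.

Lemma dfwith_insert s t y : dfwith (insert_coord s y) k t = insert_coord t y.
Proof. by rewrite -insert_omit omit_insert. Qed.

Lemma insert_dfwith t y j s :
  insert_coord t (dfwith y j s) = dfwith (insert_coord t y) (lift k j) s.
Proof.
apply: functional_extensionality_dep => i; case: (unliftP k i) => [l ->|->].
  rewrite insert_coord_lift; have [jl|jl] := eqVneq j l.
    by move: s; rewrite jl => s; rewrite !dfwithin.
  rewrite !dfwithout ?insert_coord_lift//.
  by apply: contra jl => /eqP/lift_inj ->.
by rewrite dfwithout ?insert_coord_at// eq_sym neq_lift.
Qed.

Lemma omit_coord_continuous : continuous (@omit_coord n X k).
Proof. by apply: continuous_prodP => j; exact: component_continuous. Qed.

Lemma insert_coord_continuous t : continuous (insert_coord t).
Proof.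
apply: continuous_prodP => i; case: (unliftP k i) => [j ->|->].
  under eq_fun do rewrite insert_coord_lift; exact: component_continuous.
by under eq_fun do rewrite insert_coord_at; exact: cst_continuous.
Qed.

(** An interior point [x] of the closure of the cylinder, restricted to the slice at [x k], would
    give an interior point of [closure N]. *)
Lemma nowhere_dense_omit (N : set (omit_prod X k)) :
  nowhere_dense N -> nowhere_dense (@omit_coord n X k @^-1` N).
Proof.
move=> nN; rewrite /nowhere_dense -subset0 => x.
have cN : closed (@omit_coord n X k @^-1` closure N).
  by apply: preimage_closed; [move=> ? _; exact: omit_coord_continuous|
    exact: closed_closure].
have sN : closure (@omit_coord n X k @^-1` N) `<=` @omit_coord n X k @^-1` closure N.
  rewrite (closure_id (@omit_coord n X k @^-1` closure N)).1//; apply: closureS => y Ny.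
  exact: (@subset_closure _ N).
move=> /(interiorS sN) xN.
suff : (closure N)^° (omit_coord k x) by rewrite nN.
have xE : insert_coord (x k) (omit_coord k x) = x.
  by apply: prod_eqP; rewrite ?insert_coord_at ?omit_insert.
have : nbhs (insert_coord (x k) (omit_coord k x))
    (@omit_coord n X k @^-1` closure N) by rewrite xE.
move=> /insert_coord_continuous/= xkN; 
apply: (@filterS _ (nbhs (omit_coord k x : omit_prod X k)) _ _ _ _ xkN) => y /=.
by rewrite omit_insert.
Qed.

Lemma meagre_omit (A : set (omit_prod X k)) :
  meagre A -> meagre (@omit_coord n X k @^-1` A).
Proof.
move=> [F nF ->]; apply: (@meagre_cover _ _ (fun i => @omit_coord n X k @^-1` F i)).
  by move=> i; exact: nowhere_dense_omit.
by move=> x [i _ Fx]; exists i.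
Qed.

Lemma metrizable_omit (R : realType) : (forall i, metrizable R (X i)) ->
  metrizable R (omit_prod X k).
Proof. by move=> mX; exact: metrizable_prod. Qed.

Lemma separately_continuous_insert (R : realType) (f : prod_topology X -> R) t :
  separately_continuous f ->
  separately_continuous (fun y : omit_prod X k => f (insert_coord t y)).
Proof.
move=> sf j y; under eq_fun do rewrite insert_dfwith.
exact: sf.
Qed.

Lemma separately_continuous_at (R : realType) (f : prod_topology X -> R) y :
  separately_continuous f -> continuous (fun t => f (insert_coord t y)).
Proof.
move=> sf t; have := sf k (insert_coord t y).
by under eq_fun do rewrite dfwith_insert; exact.
Qed.

End Insertion.

Arguments separately_continuous_insert {n X k R f} t _.
Arguments separately_continuous_at {n X k R f} y _.

(** * Discontinuities of separately continuous functions *)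

Section Oscillation.
Variables (R : realType) (T : topologicalType) (f : T -> R).

(** The gap [e] must be attained by a pair in every neighbourhood, which avoids suprema; the sets
    for [e = 1 / (a + 1)] still exhaust the discontinuities. *)
Definition oscillation_ge (e : R) : set T := [set x : T |
  forall U, nbhs x U -> exists y z, [/\ U y, U z & e <= `|f y - f z|]].

Lemma closed_oscillation_ge e : closed (oscillation_ge e).
Proof.
move=> x xe U /nbhs_interior/xe[w [we Uw]].
by have [y [z [Uy Uz yz]]] := we _ Uw; exists y, z.
Qed.

Lemma oscillation_ge_discontinuity e : 0 < e ->
  oscillation_ge e `<=` discontinuity_set f.
Proof.
move=> e0 x xe /cvgrPdist_lt/(_ (e / 2)) cf.
have /xe[y [z [fy fz yz]]] := cf (divr_gt0 e0 (ltr0n _ 2)).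
have := ler_distD (f x) (f y) (f z); rewrite (distrC (f y) (f x)).
by move: fy fz => /=; lra.
Qed.

Lemma discontinuity_setE :
  discontinuity_set f = \bigcup_(a : nat) oscillation_ge a.+1%:R^-1.
Proof.
rewrite eqEsubset; split=> [x xf|x [a _]]; last first.
  by apply: oscillation_ge_discontinuity; rewrite invr_gt0.
apply: contrapT => xo; apply: xf; apply/cvgrPdist_lt => e e0.
have [a _ /(_ _ (leqnn a)) ae] := near_infty_natSinv_lt (PosNum e0).
have : ~ oscillation_ge a.+1%:R^-1 x by move=> ?; apply: xo; exists a.
move=> /existsNP[U /not_implyP[xU /forallNP Uf]].
apply: filterS (xU) => y Uy; rewrite ltNge; apply/negP => exy.
have /forallNP/(_ y) := Uf x; apply; split=> //.
  exact: nbhs_singleton xU.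
by apply: le_trans exy; exact: ltW.
Qed.

End Oscillation.

Lemma metrizable_countable_nbhs (R : realType) (T : topologicalType) (x : T) :
  metrizable R T -> exists B : (set T)^nat, (forall j, nbhs x (B j)) /\
    forall U, nbhs x U -> exists j, B j `<=` U.
Proof.
move=> /metrizableP[d [_ _ _ _ [_ dn]]].
exists (fun j => [set z | d x z < j.+1%:R^-1]); split=> [j|U].
  by apply/dn; exists j.+1%:R^-1 => //; rewrite invr_gt0.
move=> /dn[e e0 eU]; have [j _ /(_ _ (leqnn j)) je] := near_infty_natSinv_lt (PosNum e0).
by exists j => z zj; apply: eU; exact: lt_trans zj je.
Qed.

Lemma not_meagre_ex (T : topologicalType) (A M : set T) :
  ~ meagre A -> meagre M -> exists2 x, A x & ~ M x.
Proof.
move=> nA mM; apply: contrapT => /forall2NP AM; apply: nA.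
apply: meagre_sub mM => x Ax; apply: contrapT => nMx.
by have [] := AM x.
Qed.

(* Kempisty's quasicontinuity of separately continuous functions, made to hold
   without any Baire hypothesis by discarding a meagre set. *)
Lemma separately_continuous_quasicontinuous (R : realType) (n : nat)
    (X : 'I_n -> topologicalType) (h : prod_topology X -> R) :
  (forall i, metrizable R (X i)) -> separately_continuous h ->
  forall (y : prod_topology X) V (e : R), nbhs y V -> 0 < e -> exists W : set (prod_topology X),
    [/\ open W, W !=set0, W `<=` V &
        meagre [set z | W z /\ e < `|h z - h y|]].
Proof.
elim: n X h => [|n IH] X h mX sh y V e yV e0.
  exists (interior V); split.
  - exact: open_interior.
  - by exists y.
  - exact: interior_subset.
  - apply: meagre_sub (nowhere_dense_meagre (@nowhere_dense0 _)) => z [_].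
    have -> : z = y by apply: functional_extensionality_dep; case.
    by rewrite subrr normr0; lra.
(* One third is spent within the slice at [y k], one on moving along the [k]-th coordinate, one
   within the slice at [x k]. *)
pose k : 'I_n.+1 := ord0; pose e3 := e / 3.
have e30 : 0 < e3 by rewrite divr_gt0.
have IHk t := IH _ _ (fun j => mX (lift k j)) (separately_continuous_insert t sh).
have mY : metrizable R (omit_prod X k) by exact: metrizable_omit.
have yE : insert_coord (y k) (omit_coord k y) = y.
  by apply: (@prod_eqP _ _ k); rewrite ?insert_coord_at ?omit_insert.
have [B yB BV] := (nbhs_prodP _ _).1 yV.
pose V1 : set (omit_prod X k) := [set z | forall j, B (lift k j) (z j)].
have yV1 : nbhs (omit_coord k y : omit_prod X k) V1.
  by apply/nbhs_prodP; exists (fun j => B (lift k j)) => // j; exact: yB.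
have V12 x : V1 (omit_coord k x) -> B k (x k) -> V x.
  move=> V1x Bx; apply: BV => i.
  by case: (unliftP k i) => [j|] ->//; exact: V1x.
have [W1 [oW1 [z0 W1z0] W1V mW1]] := IHk (y k) _ _ _ yV1 e30.
rewrite yE in mW1.
have boxP (W : set (omit_prod X k)) (U : set (X k)) : open W -> W !=set0 ->
    nbhs (y k) U -> let A := [set x | W (omit_coord k x) /\ interior U (x k)] in
    open A /\ A !=set0.
  move=> oW [z Wz] yU A; split.
    apply: openI; apply: open_comp => //; try exact: open_interior.
      by move=> x _; exact: omit_coord_continuous.
    by move=> x _; exact: (@component_continuous _ X k x).
  by exists (insert_coord (y k) z); split; rewrite /= ?omit_insert ?insert_coord_at.
have [mW|nmW] := pselect (meagre W1).
  have [oA neA] := boxP W1 (B k) oW1 (ex_intro _ _ W1z0) (yB k).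
  exists [set x | W1 (omit_coord k x) /\ interior (B k) (x k)]; split=> //.
    by move=> x [/W1V V1x /interior_subset]; exact: V12.
  by apply: meagre_sub (@meagre_omit _ X k _ mW) => x [[]].
have [C [yC Cbase]] := metrizable_countable_nbhs (y k) (mX k).
(* Continuity in the [k]-th variable puts every point of [W1], off the meagre exceptional set, into
   some [A j]; as [W1] is not meagre, neither is some [A j]. *)
pose A j : set (omit_prod X k) := [set z : omit_prod X k | W1 z /\ forall s, C j s ->
  `|h (insert_coord s z) - h y| <= 2 * e3].
have [j nmA] : exists j, ~ meagre (A j).
  apply: contrapT => /forallNP mA; apply: nmW.
  have {}mA : meagre (\bigcup_j A j).
    by apply: (@meagre_countable _ _ _ A) => // j; exact: contrapT (mA j).
  apply: meagre_sub (meagreU mW1 mA) => z W1z.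
  have [ze|ze] := ltP e3 `|h (@insert_coord _ X k (y k) z) - h y|; [by left|right].
  have /cvgrPdist_lt/(_ _ e30)/Cbase[j Cj] := @separately_continuous_at _ X k _ _ z sh (y k).
  exists j => //; split=> // s /Cj/= sz.
  have := ler_distD (h (@insert_coord _ X k (y k) z)) (h (@insert_coord _ X k s z)) (h y).
  rewrite (distrC (h (@insert_coord _ X k s z)) (h (@insert_coord _ X k (y k) z))).
  by lra.
have [G [oG mG nG]] := meagre_kernel mY (A j).
have [z1 [W1z1 Az1] Gz1] : exists2 z, A j z & ~ (A j `\` G) z.
  exact: not_meagre_ex.
have {}Gz1 : G z1.
  by apply: contrapT => nG1; apply: Gz1; split.
pose W' := G `&` W1; have oW' : open W' by exact: openI.
have [oW neW] := boxP W' (B k `&` C j) oW' (ex_intro _ _ (conj Gz1 W1z1))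
  (filterI (yB k) (yC j)).
exists [set x | W' (omit_coord k x) /\ interior (B k `&` C j) (x k)]; split=> //.
  by move=> x [[_ /W1V V1x] /interior_subset[Bx _]]; exact: V12.
(* The box has no exceptional point: induction in the slice at [x k] gives an open [W2] inside [G],
   where the nowhere meagre [A j] has a point [z] with value close to both [h x] and [h y]. *)
apply: meagre_sub (nowhere_dense_meagre (@nowhere_dense0 _)) => x [[W'x]].
move=> /interior_subset[_ Cx]; apply/negP; rewrite -leNgt.
have xW' : nbhs (omit_coord k x : omit_prod X k) W' by exact: open_nbhs_nbhs.
have [W2 [oW2 [z2 W2z2] W2W' mW2]] := IHk (x k) _ _ _ xW' e30.
have W2G : W2 `&` G !=set0 by exists z2; split=> //; have [] := W2W' _ W2z2.
have [z [[_ /(_ _ Cx) Az] W2z] /not_andP[//|/negP]] :=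
  not_meagre_ex (nG _ oW2 W2G) mW2.
rewrite -leNgt insert_omit (_ : dfwith x k (x k) = x); last first.
  by rewrite -insert_omit; apply: (@prod_eqP _ _ k); rewrite ?insert_coord_at ?omit_insert.
have := ler_distD (h (@insert_coord _ X k (x k) z)) (h x) (h y).
rewrite (distrC (h x) (h (insert_coord _ _))); move: Az; rewrite /e3; lra.
Qed.

Section Slices.
Variables (R : realType) (n : nat) (X : 'I_n -> topologicalType) (k : 'I_n).
Hypothesis X_metrizable : forall i, metrizable R (X i).
Variable f : prod_topology X -> R.
Hypothesis f_sc : separately_continuous f.

Definition oscillating_slices (e : R) (U : set (X k)) : set (omit_prod X k) :=
  [set y | (forall s t, U s -> U t ->
      `|f (insert_coord s y) - f (insert_coord t y)| <= e / 7) /\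
    exists2 s, U s & oscillation_ge f e (insert_coord s y)].

(** By continuity in the [k]-th variable, a basic set around [x k] keeps the values within [e / 14]
    of [f x], hence within [e / 7] of each other. *)
Lemma oscillation_ge_slices (e : R) (S W : nat * nat -> X k -> set (X k)) :
  0 < e -> (forall q c, S q c `<=` W q c) ->
  (forall s U, nbhs s U -> exists q c, S q c s /\ W q c `<=` U) ->
  forall x, oscillation_ge f e x -> exists q c,
    S q c (x k) /\ oscillating_slices e (W q c) (omit_coord k x).
Proof.
move=> e0 SW base x xe; have e14 : 0 < e / 14 by rewrite divr_gt0.
have xE : insert_coord (x k) (omit_coord k x) = x.
  by apply: (@prod_eqP _ _ k); rewrite ?insert_coord_at ?omit_insert.
have /cvgrPdist_lt/(_ _ e14)/base[q [c [Sx Wf]]] :=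
  separately_continuous_at (omit_coord k x) f_sc (x k).
exists q, c; split=> //; split.
  move=> s t /Wf/= fs /Wf/= ft; rewrite xE in fs ft.
  have := ler_distD (f x) (f (insert_coord s (omit_coord k x)))
    (f (insert_coord t (omit_coord k x))).
  by rewrite (distrC _ (f x)); lra.
by exists (x k); [exact: SW|rewrite xE].
Qed.

(** Fix [t] in [U]. At a point of [G] where the slice of [f] at [t] is continuous, [f] cannot
    oscillate by [e] over [U]; the points left out lie in two meagre sets. *)
Lemma meagre_oscillating_slices (e : R) (U : set (X k)) :
  (forall g : omit_prod X k -> R, separately_continuous g ->
    meagre (discontinuity_set g)) ->
  0 < e -> open U -> meagre (oscillating_slices e U).
Proof.
move=> IH e0 oU; have e7 : 0 < e / 7 by rewrite divr_gt0.
have [[t Ut]|nU] := pselect (U !=set0); last first.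
  apply: meagre_sub (nowhere_dense_meagre (@nowhere_dense0 _)) => y [_ [s Us]].
  by case: nU; exists s.
have mY : metrizable R (omit_prod X k) by exact: metrizable_omit.
pose A : set (omit_prod X k) := [set y : omit_prod X k | forall s t, U s -> U t ->
      `|f (insert_coord s y) - f (insert_coord t y)| <= e / 7].
have [G [oG mG nG]] := meagre_kernel mY A.
have mt := IH _ (separately_continuous_insert t f_sc).
apply: meagre_sub (meagreU mt mG) => y [Ay [s0 Us0 osc]].
have [Gy|nGy] := pselect (G y); [left|by right]; move=> cy.
(* Quasicontinuity of the difference [h] of two slices carries the bound from [A] to all of [G], at
   the cost of another [e / 7]. *)
have GU y' s : G y' -> U s ->
    `|f (insert_coord s y') - f (insert_coord t y')| <= 2 * (e / 7).
  move=> Gy' Us.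
  pose h (z : omit_prod X k) := f (insert_coord s z) - f (insert_coord t z).
  have sh : separately_continuous h.
    move=> j z u; apply: cvgB.
      exact: (separately_continuous_insert s f_sc).
    exact: (separately_continuous_insert t f_sc).
  have y'G : nbhs y' G by exact: open_nbhs_nbhs.
  have [V [oV [v Vv] VG mV]] := separately_continuous_quasicontinuous
    (fun j => X_metrizable (lift k j)) sh y'G e7.
  have [|z [Az Vz] /not_andP[//|/negP]] := not_meagre_ex (nG V oV _) mV.
    by exists v; split=> //; exact: VG.
  rewrite -leNgt -/(h y') => hz; have {}Az : `|h z| <= e / 7 by exact: Az.
  have := ler_distD (h z) (h y') 0; rewrite !subr0 (distrC (h y')); lra.
move: cy => /cvgrPdist_lt/(_ _ e7)/= cy.
have /osc[x [x' [[Ux [Gx cx]] [Ux' [Gx' cx']] xx']]] :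
    nbhs (insert_coord s0 y) [set x | U (x k) /\ (G (omit_coord k x) /\
      `|f (insert_coord t y) - f (insert_coord t (omit_coord k x))| < e / 7)].
  apply: filterI; last apply: filterI.
  - apply: (@component_continuous _ X k (insert_coord s0 y)).
    by rewrite insert_coord_at; exact: open_nbhs_nbhs.
  - apply: (@omit_coord_continuous _ X k (insert_coord s0 y)).
    by rewrite omit_insert; exact: open_nbhs_nbhs.
  - apply: (@omit_coord_continuous _ X k (insert_coord s0 y) [set z |
      `|f (insert_coord t y) - f (@insert_coord _ X k t z)| < e / 7]).
    by rewrite omit_insert.
have key z : U (z k) -> G (omit_coord k z) ->
    `|f z - f (insert_coord t (omit_coord k z))| <= 2 * (e / 7).
  move=> Uz Gz; have := GU _ _ Gz Uz.
  rewrite (_ : insert_coord (z k) (omit_coord k z) = z)//.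
  by apply: (@prod_eqP _ _ k); rewrite ?insert_coord_at ?omit_insert.
(* The four steps from [f x] to [f x'] cost less than (2 + 1 + 1 + 2) [e / 7], which is below
   [e]. *)
have := key _ Ux Gx; have := key _ Ux' Gx'; move: cx cx' xx'.
set a := f x; set b := f x'; set a' := f (insert_coord t (omit_coord k x)).
set b' := f (insert_coord t (omit_coord k x')); set c := f (insert_coord t y).
have := ler_distD a' a b; have := ler_distD c a' b; have := ler_distD b' c b.
by rewrite (distrC b' b) (distrC a' c); lra.
Qed.

End Slices.

(** Countably many unions, discrete in [c], of cylinders over oscillating slices cover the
    discontinuities; induction supplies the hypothesis that makes these slices meagre. *)
Theorem meagre_discontinuity_set (R : realType) (n : nat)
    (X : 'I_n -> topologicalType) (f : prod_topology X -> R) :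
  (forall i, metrizable R (X i)) -> separately_continuous f ->
  meagre (discontinuity_set f).
Proof.
elim: n X f => [|n IH] X f mX sf.
  apply: meagre_sub (nowhere_dense_meagre (@nowhere_dense0 _)) => x.
  apply => A /= /nbhs_singleton Afx.
  apply: (@filterS _ (nbhs x) _ setT) filterT => z _ /=.
  by have -> : z = x by apply: functional_extensionality_dep; case.
pose k : 'I_n.+1 := ord0.
have [S [W [cS oW SW dW base]]] := sigma_discrete_base (mX k).
rewrite discontinuity_setE; apply: (@meagre_countable _ (nat * (nat * nat))%type _
  (fun aq => \bigcup_c [set x : prod_topology X | W aq.2 c (x k) /\
     oscillating_slices f aq.1.+1%:R^-1 (W aq.2 c) (omit_coord k x)])).
  move=> [a q] /=; apply: meagre_discrete => [|c].
    apply: (discrete_family_sub _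
      (discrete_family_preimage (@component_continuous _ X k) (dW q))).
    by move=> c x [].
  have : meagre (oscillating_slices f a.+1%:R^-1 (W q c)).
    apply: meagre_oscillating_slices => //.
    by move=> g; apply: IH => j; exact: mX.
  by move=> /meagre_omit; apply: meagre_sub => x [].
move=> x [a _ xa]; have a0 : 0 < a.+1%:R^-1 :> R by rewrite invr_gt0.
have [q [c [Sx Nx]]] := oscillation_ge_slices sf a0 SW base xa.
by exists (a, q) => //; exists c => //; split=> //; exact: SW.
Qed.

(** * Decomposition of the discontinuity set *)

Section Decomposition.
Variables (R : realType) (n : nat) (X : 'I_n -> topologicalType).
Hypothesis X_metrizable : forall i, metrizable R (X i).

Lemma locally_projectively_meagre_sub (A B : set (prod_topology X)) k :
  A `<=` B -> locally_projectively_meagre_wrt k B ->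
  locally_projectively_meagre_wrt k A.
Proof.
move=> AB mB x; have [U xU mU] := mB x; exists U => //.
by apply: meagre_sub mU; apply: image_subset; exact: setSI.
Qed.

(** The closed [S] and the closures of the [F] make the pieces closed. Near a point only one [c]
    matters, so the projection there lies in one nowhere dense closure. *)
Lemma oscillation_ge_cover (f : prod_topology X -> R) (e : R) (k : 'I_n) :
  separately_continuous f -> 0 < e ->
  exists T : nat * nat * nat -> set (prod_topology X),
    [/\ forall p, closed (T p),
        forall p, locally_projectively_meagre_wrt k (T p) &
        oscillation_ge f e `<=` \bigcup_p T p].
Proof.
move=> sf e0; have [S [W [cS oW SW dW base]]] := sigma_discrete_base (X_metrizable k).
have /choice[F FP] : forall qc : (nat * nat) * X k,
    exists Fi : (set (omit_prod X k))^nat, (forall i, nowhere_dense (Fi i)) /\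
      oscillating_slices f e (W qc.1 qc.2) = \bigcup_i Fi i.
  move=> [q c] /=; have [|//|//|Fi] := @meagre_oscillating_slices R n X k
    X_metrizable f sf e (W q c); last by exists Fi.
  by move=> g; apply: meagre_discontinuity_set => j; exact: X_metrizable.
pose T (p : nat * nat * nat) c := [set x : prod_topology X |
  S p.1 c (x k) /\ closure (F (p.1, c) p.2) (omit_coord k x)].
exists (fun p => \bigcup_c T p c); split.
- move=> p; apply: closed_discrete => [|c].
    apply: (discrete_family_sub _
      (discrete_family_preimage (@component_continuous _ X k) (dW p.1))).
    by move=> c x [/SW].
  apply: closedI; apply: preimage_closed => //; try exact: closed_closure.
    by move=> x _; exact: (@component_continuous _ X k x).
  by move=> x _; exact: omit_coord_continuous.
- move=> p x; have [c xc] := dW p.1 (x k).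
  exists ((fun y : prod_topology X => y k) @^-1`
      [set z | forall c', W p.1 c' z -> c' = c]).
    exact: (@component_continuous _ X k x).
  have := nowhere_dense_meagre (nowhere_dense_closure ((FP (p.1, c)).1 p.2)).
  apply: meagre_sub => _ [y [[c' _ [Sy Fy]] /= yc] <-].
  by rewrite -(yc _ (SW _ _ _ Sy)).
- move=> x xe; have [q [c [Sx]]] := oscillation_ge_slices sf e0 SW base xe.
  rewrite (FP (q, c)).2 => -[i _ Fx]; exists (q, i) => //; exists c => //.
  by split=> //; exact: subset_closure.
Qed.

(** Each direction [k] has its own cover; intersecting one member per direction serves all at once,
    and finite functions keep the choices countable. Intersecting with the oscillation set stays
    inside the discontinuities. *)
Lemma discontinuity_set_decomposition (f : prod_topology X -> R) :
  separately_continuous f -> exists Em : (set (prod_topology X))^nat,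
    discontinuity_set f = \bigcup_m Em m /\
    forall m, Fsigma (Em m) /\ locally_projectively_meagre (Em m).
Proof.
move=> sf; have /choice[T TP] : forall ak : nat * 'I_n,
    exists T : nat * nat * nat -> set (prod_topology X),
    [/\ forall p, closed (T p),
        forall p, locally_projectively_meagre_wrt ak.2 (T p) &
        oscillation_ge f ak.1.+1%:R^-1 `<=` \bigcup_p T p].
  by move=> [a k]; apply: oscillation_ge_cover => //=; rewrite invr_gt0.
pose I := (nat * {ffun 'I_n -> nat * nat * nat})%type.
pose E (i : I) := oscillation_ge f i.1.+1%:R^-1 `&`
  \bigcap_(k in [set: 'I_n]) T (i.1, k) (i.2 k).
exists (fun m => if @unpickle I m is Some i then E i else set0); split.
  rewrite discontinuity_setE eqEsubset; split=> x.
    move=> [a _ xa]; have /choice[phi phiP] : forall k, exists p, T (a, k) p x.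
      by move=> k; have [_ _ /(_ _ xa)[p]] := TP (a, k); exists p.
    exists (pickle ((a, [ffun k => phi k]) : I)) => //; rewrite pickleK; split=> //.
    by move=> k _; rewrite /= ffunE.
  by move=> [m _]; case: unpickle => [[a phi] [xa _]|//]; exists a.
move=> m; case: unpickle => [[a phi]|]; last first.
  split; first exact: closed_Fsigma closed0.
  move=> k x; exists setT; first exact: filterT.
  apply: meagre_sub (nowhere_dense_meagre (@nowhere_dense0 _)).
  by move=> y [z []].
split.
  apply: closed_Fsigma; apply: closedI; first exact: closed_oscillation_ge.
  by apply: closed_bigI => k _; have [] := TP (a, k).
move=> k; have [_ + _] := TP (a, k) => /(_ (phi k)).
by apply: locally_projectively_meagre_sub => x [_ /(_ k)]; exact.
Qed.

End Decomposition.

(** * Bump functions and weighted sums *)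

Section Distance.
Variables (R : realType) (T : Type) (d : T -> T -> R).
Hypothesis d_ge0 : forall x y, 0 <= d x y.
Hypothesis dxx : forall x, d x x = 0.
Hypothesis dC : forall x y, d x y = d y x.
Hypothesis dD : forall x y z, d x z <= d x y + d y z.

Definition set_dist (A : set T) (x : T) : R := inf [set d x a | a in A].

Variable A : set T.
Hypothesis A_neq0 : A !=set0.

Lemma set_dist_le x a : A a -> set_dist A x <= d x a.
Proof.
move=> Aa; apply: ge_inf; last by exists a.
by exists 0 => _ [b _ <-].
Qed.

Lemma le_set_dist x e : (forall a, A a -> e <= d x a) -> e <= set_dist A x.
Proof.
move=> eA; apply: lb_le_inf; last by move=> _ [a Aa <-]; exact: eA.
by have [a Aa] := A_neq0; exists (d x a), a.
Qed.

Lemma set_dist_ge0 x : 0 <= set_dist A x.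
Proof. exact: le_set_dist. Qed.

Lemma set_dist_eq0 x : A x -> set_dist A x = 0.
Proof.
move=> Ax; apply/eqP; rewrite eq_le set_dist_ge0 andbT.
by rewrite -(dxx x) set_dist_le.
Qed.

Lemma set_dist_lipschitz x y : set_dist A x <= d x y + set_dist A y.
Proof.
rewrite -lerBlDl; apply: le_set_dist => a Aa; rewrite lerBlDl.
exact: le_trans (set_dist_le _ Aa) (dD _ _ _).
Qed.

End Distance.

Lemma closed_bump (R : realType) (T : topologicalType) (E L : set T) :
  metrizable R T -> E `<=` L -> closed E -> closed L -> nowhere_dense L ->
  exists f : T -> R, [/\ forall x, 0 <= f x <= 1, forall x, L x -> f x = 0,
    forall x, ~ E x -> {for x, continuous f} &
    forall x U, E x -> nbhs x U -> exists2 z, U z & f z = 1].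
Proof.
move=> /metrizableP[d [d_ge0 dxx dC dD [d_eq0 dn]]] EL cE cL nL.
have [[e0 Ee0]|/set0P/negP/negPn/eqP E0] := pselect (E !=set0); last first.
  exists (fun=> 0); split=> //.
  - by move=> x; rewrite lexx ler01.
  - by move=> x _; exact: cst_continuous.
  - by rewrite E0.
have E_neq0 : E !=set0 by exists e0.
have L_neq0 : L !=set0 by exists e0; exact: EL.
have dist_le A x a : A a -> set_dist d A x <= d x a by exact: set_dist_le.
have dist_gt0 A x : A !=set0 -> closed A -> ~ A x -> 0 < set_dist d A x.
  move=> A0 cA nAx; have /dn[r r0 rA] : nbhs x (~` A).
    by apply: open_nbhs_nbhs; split=> //; exact: closed_openC.
  apply: lt_le_trans r0 _; apply: le_set_dist => // a Aa.
  by rewrite leNgt; apply/negP => /rA.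
have dist_cont A x : A !=set0 -> {for x, continuous (set_dist d A)}.
  move=> A0; apply/cvgrPdist_lt => r r0; apply/dn; exists r => // z xz.
  have := set_dist_lipschitz d_ge0 dD A0 x z.
  have := set_dist_lipschitz d_ge0 dD A0 z x.
  by rewrite (dC z x) ltr_norml => *; apply/andP; split; lra.
(* The separation is proportional to the distance from [E], so a maximal such set accumulates only
   at [E]. *)
pose P := [set Z : set T | Z `<=` ~` L /\
  forall z z', Z z -> Z z' -> z <> z' -> set_dist d E z <= 2 * d z z'].
have [F FP Ftot|Z [[ZL Zsep] Zmax]] := @Zorn_bigcup T P.
  split=> [x [Y /FP[YL _] Yx]|z z' [Y FY Yz] [Y' FY' Yz']]; first exact: YL.
  have [YY'|Y'Y] := Ftot _ _ FY FY'.
    by have [_] := FP _ FY'; apply => //; exact: YY'.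
  by have [_] := FP _ FY; apply => //; exact: Y'Y.
(* If [Z] missed the ball of radius [r] about [x], a point [y] off [L] within [r / 2] of [x] could
   be added to it, against maximality. *)
have EZ x U : E x -> nbhs x U -> exists2 z, Z z & U z.
  move=> Ex /dn[r r0 rU]; apply: contrapT => /forall2NP nZ.
  have {}nZ z : Z z -> r <= d x z.
    by move=> Zz; rewrite leNgt; apply/negP => /rU; have [] := nZ z.
  have r20 : 0 < r / 2 by rewrite divr_gt0.
  have [y xy nLy] : exists2 y, d x y < r / 2 & ~ L y.
    apply: contrapT => /forall2NP xL; suff : (closure L)^° x by rewrite nL.
    apply/dn; exists (r / 2) => // z xz; apply: subset_closure.
    by apply: contrapT; have [] := xL z.
  have nZy : ~ Z y by move=> /nZ; lra.
  apply: (Zmax (Z `|` [set y])).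
    split; last by move=> /(_ y (or_intror erefl)).
    by move=> ?; left.
  split=> [z [/ZL//|->//]|z z' [Zz|->] [Zz'|->] zz'//].
  - exact: Zsep.
  - have := dist_le _ z _ Ex; have := dD x y z; have := nZ _ Zz.
    by have := dD z y x; rewrite (dC z y) (dC y x); lra.
  - have := dist_le _ y _ Ex; have := dD x y z'; have := nZ _ Zz'.
    by rewrite (dC y x); lra.
have [z0 Zz0 _] := EZ e0 setT Ee0 filterT.
have Z_neq0 : Z !=set0 by exists z0.
(* A point of [Z] within [r / 8] of [x] is at least [7 r / 8] from [E], hence at least [7 r / 16]
   from the rest of [Z]; so it is the nearest one to [x]. *)
have Z_gt0 x : ~ E x -> ~ Z x -> 0 < set_dist d Z x.
  move=> nEx nZx; have r0 := dist_gt0 E x E_neq0 cE nEx.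
  set r := set_dist d E x in r0.
  have [[z Zz xz]|nz] := pselect (exists2 z, Z z & d x z < r / 8); last first.
    apply: (@lt_le_trans _ _ (r / 8)); first by rewrite divr_gt0.
    apply: le_set_dist => // a Za; rewrite leNgt; apply/negP => xa.
    by apply: nz; exists a.
  apply: (@lt_le_trans _ _ (d x z)).
    rewrite lt_neqAle d_ge0 andbT; apply/eqP => /esym/d_eq0 xz0.
    by apply: nZx; rewrite xz0.
  apply: le_set_dist => // a Za; rewrite leNgt; apply/negP => xa.
  have za : z <> a by move=> za; move: xa; rewrite za ltxx.
  have := Zsep _ _ Zz Za za; have := set_dist_lipschitz d_ge0 dD E_neq0 x z.
  by have := dD z x a; rewrite (dC z x) -/r; lra.
have L_ge0 x : 0 <= set_dist d L x by exact: set_dist_ge0.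
have Z_ge0 x : 0 <= set_dist d Z x by exact: set_dist_ge0.
exists (fun x => set_dist d L x / (set_dist d L x + set_dist d Z x)); split.
- move=> x; rewrite divr_ge0 ?addr_ge0//=.
  (* On [E] both distances vanish, and the convention that 0 has inverse 0 gives the value 0. *)
  have [->|LZ] := eqVneq (set_dist d L x + set_dist d Z x) 0.
    by rewrite invr0 mulr0.
  by rewrite ler_pdivrMr ?mul1r ?lerDl// lt_neqAle eq_sym LZ addr_ge0.
- by move=> x Lx; rewrite (set_dist_eq0 d_ge0 dxx L_neq0)// mul0r.
- move=> x nEx; apply: cvgM; first exact: dist_cont.
  apply: cvgV; last by apply: cvgD; exact: dist_cont.
  have [Lx|nLx] := pselect (L x).
    by rewrite gt_eqF// ltr_wpDl// Z_gt0// => /ZL.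
  by rewrite gt_eqF// ltr_pwDl// dist_gt0.
- move=> x U Ex xU; have [z Zz Uz] := EZ _ _ Ex xU; exists z => //.
  rewrite (set_dist_eq0 d_ge0 dxx Z_neq0)// addr0 divff// gt_eqF//.
  by apply: dist_gt0 => //; exact: ZL.
Qed.

Section WeightedSum.
Variables (R : realType) (T : topologicalType).
Implicit Types (f : nat -> T -> R) (x : T).

Definition partial_sum f (N : nat) (x : T) : R :=
  \sum_(q < N) 2^-1 ^+ q * f q x.

Lemma half_pow_small (e : R) : 0 < e -> exists N0, forall N, (N0 <= N)%N ->
  2 * 2^-1 ^+ N < e.
Proof.
move=> e0; have : 2^-1 ^+ N @[N --> \oo] --> (0 : R).
  by apply: cvg_expr; rewrite ger0_norm ?invr_ge0// invf_lt1 ?ltr1n.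
move=> /cvgrPdist_lt/(_ (e / 2))[|N0 _ N0e]; first by rewrite divr_gt0.
exists N0 => N /N0e/=; rewrite sub0r normrN ger0_norm ?exprn_ge0 ?invr_ge0//; lra.
Qed.

(** The term [2 * 2^-1 ^+ N] is the total weight from [N] on: partial sums increase, and decrease
    once it is added. This sandwich stands for uniform convergence. *)
Lemma partial_sum_limit f : (forall q x, 0 <= f q x <= 1) ->
  exists F : T -> R, forall N x,
    partial_sum f N x <= F x <= partial_sum f N x + 2 * 2^-1 ^+ N.
Proof.
move=> f01; have w0 N : 0 <= 2^-1 ^+ N :> R by rewrite exprn_ge0 ?invr_ge0.
have up x : {homo (fun N => partial_sum f N x) : n m / (n <= m)%N >-> n <= m}.
  apply/nondecreasing_seqP => N; rewrite /partial_sum big_ord_recr/= lerDl.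
  by apply: mulr_ge0 => //; have /andP[] := f01 N x.
have down x : {homo (fun N => partial_sum f N x + 2 * 2^-1 ^+ N) :
    n m / (n <= m)%N >-> n >= m}.
  apply/nonincreasing_seqP => N; rewrite /partial_sum big_ord_recr/= exprS.
  have /andP[_ f1] := f01 N x.
  have : 2^-1 ^+ N * f N x <= 2^-1 ^+ N by rewrite ler_piMr.
  lra.
have bnd x N M : partial_sum f M x <= partial_sum f N x + 2 * 2^-1 ^+ N.
  have c0 M' : 0 <= 2 * 2^-1 ^+ M' :> R by rewrite mulr_ge0.
  have [/up|/ltnW/down] := leqP M N => /(_ x) h.
    by apply: le_trans h _; rewrite lerDl.
  by apply: le_trans h; rewrite lerDl.
exists (fun x => sup (range (fun N => partial_sum f N x))) => N x.
apply/andP; split; last first.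
  apply: ge_sup; first by exists (partial_sum f 0 x), 0%N.
  by move=> _ [M _ <-].
apply: ub_le_sup; last by exists N.
by exists (partial_sum f 0 x + 2 * 2^-1 ^+ 0) => _ [M _ <-].
Qed.

Lemma partial_sum_continuous f x : (forall q, {for x, continuous (f q)}) ->
  forall N, {for x, continuous (partial_sum f N)}.
Proof.
move=> cf; elim=> [|N IH].
  have -> : partial_sum f 0 = fun=> 0.
    by apply/funext => y; rewrite /partial_sum big_ord0.
  exact: cst_continuous.
have -> : partial_sum f N.+1 = fun y => partial_sum f N y + 2^-1 ^+ N * f N y.
  by apply/funext => y; rewrite /partial_sum big_ord_recr.
apply: cvgD; first exact: IH.
by apply: cvgM; [exact: cvg_cst|exact: cf].
Qed.

(** The sequence is arbitrary so as to apply both on the product and along a coordinate line. *)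
Lemma continuous_limit (s : nat -> T -> R) (F : T -> R) x :
  (forall N y, s N y <= F y <= s N y + 2 * 2^-1 ^+ N) ->
  (forall N, {for x, continuous (s N)}) -> {for x, continuous F}.
Proof.
move=> sF cs; apply/cvgrPdist_lt => e e0.
have e20 : 0 < e / 2 by rewrite divr_gt0.
have [N /(_ _ (leqnn N)) Ne] := half_pow_small e20.
have /cvgrPdist_lt/(_ _ e20) := cs N; apply: filterS => y.
have /andP[] := sF N x; have /andP[] := sF N y.
by rewrite !ltr_norml => ? ? ? ? /andP[? ?]; apply/andP; split; lra.
Qed.

Definition lower_semicontinuous_at (g : T -> R) x :=
  forall e, 0 < e -> \forall y \near x, g x - e <= g y.

Lemma lower_semicontinuous_partial_sum f x :
  (forall q, lower_semicontinuous_at (f q) x) ->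
  forall N, lower_semicontinuous_at (partial_sum f N) x.
Proof.
move=> lf; elim=> [|N IH] e e0; rewrite /partial_sum.
  by apply: filterE => y; rewrite !big_ord0; lra.
have e20 : 0 < e / 2 by rewrite divr_gt0.
apply: filterS2 (IH _ e20) (lf N _ e20) => y; rewrite /partial_sum.
rewrite !big_ord_recr/=.
set w := _ ^+ N; have w0 : 0 <= w by rewrite exprn_ge0 ?invr_ge0.
have w1 : w <= 1 by rewrite exprn_ile1 ?invr_ge0// invf_le1 ?ler1n.
by move=> ? fN; have : w * (f N x - f N y) <= e / 2; nra.
Qed.

(** Arbitrarily near [x] the [q]-th term jumps by [4 * e], while the other terms of the partial sum
    drop by at most [e] and the tail is below [e]; so [F] rises by more than [2 * e]. *)
Lemma partial_sum_limit_discontinuous f (F : T -> R) x q :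
  (forall N y, partial_sum f N y <= F y <= partial_sum f N y + 2 * 2^-1 ^+ N) ->
  (forall p, lower_semicontinuous_at (f p) x) ->
  f q x = 0 -> (forall U, nbhs x U -> exists2 z, U z & f q z = 1) ->
  ~ {for x, continuous F}.
Proof.
move=> fF lf fqx fq1 cF; pose e : R := 2^-1 ^+ q / 4.
have wq : 2^-1 ^+ q = 4 * e by rewrite /e; lra.
have e0 : 0 < e by rewrite divr_gt0 ?exprn_gt0 ?invr_gt0.
have [N0 /(_ _ (leq_maxl N0 q.+1)) Ne] := half_pow_small e0.
set N := maxn _ _ in Ne; have qN : (q < N)%N by exact: leq_maxr.
(* The [q]-th term is split off; it occurs in the partial sum because [N] exceeds [q]. *)
pose f' p := if p == q then fun=> 0 else f p.
have lf' p : lower_semicontinuous_at (f' p) x.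
  rewrite /f'; case: ifP => // _ r r0; apply: filterE => y.
  by rewrite sub0r oppr_le0 ltW.
have ff' y : partial_sum f N y = 2^-1 ^+ q * f q y + partial_sum f' N y.
  rewrite /partial_sum (bigD1 (Ordinal qN))//= [in RHS](bigD1 (Ordinal qN))//=.
  rewrite {1}/f' eqxx mulr0 add0r; congr (_ + _); apply: eq_bigr => p pq.
  by rewrite /f'; case: ifPn => // /eqP pq'; move: pq; rewrite -val_eqE/= pq' eqxx.
have /cvgrPdist_lt/(_ _ e0) xF := cF.
have [z [Fz lz] fz] := fq1 _ (filterI xF (lower_semicontinuous_partial_sum lf' N e0)).
have /andP[+ _] := fF N z; have /andP[_] := fF N x; rewrite !ff' fqx fz wq.
by move: Fz lz => /=; rewrite ltr_norml => /andP[? ?] /=; lra.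
Qed.

End WeightedSum.

(** * Prescribing the discontinuity set *)

Lemma closed_nowhere_dense_finite (T : topologicalType) (I : finType)
    (F : I -> set T) :
  (forall i, closed (F i)) -> (forall i, nowhere_dense (F i)) ->
  closed [set x | exists i, F i x] /\ nowhere_dense [set x | exists i, F i x].
Proof.
move=> cF nF.
suff : forall s : seq I, closed [set x | exists2 i, i \in s & F i x] /\
    nowhere_dense [set x | exists2 i, i \in s & F i x].
  move=> /(_ (enum I)).
  rewrite (_ : [set x | exists2 i, i \in enum I & F i x] = [set x | exists i, F i x])//.
  rewrite eqEsubset; split=> x [i]; first by exists i.
  by exists i => //; rewrite mem_enum.
elim=> [|i s [cs ns]].
  rewrite (_ : [set x | _] = set0); first by split; [exact: closed0|exact: nowhere_dense0].
  by rewrite -subset0 => x [].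
rewrite (_ : [set x | _] = F i `|` [set x | exists2 i, i \in s & F i x]).
  by split; [exact: closedU|exact: closed_nowhere_dense_setU].
rewrite eqEsubset; split=> x.
  by move=> [j]; rewrite inE => /orP[/eqP ->|js Fj]; [left|right; exists j].
by move=> [Fi|[j js Fj]]; [exists i|exists j]; rewrite ?inE ?eqxx ?js ?orbT.
Qed.

Section Construction.
Variables (R : realType) (n : nat) (X : 'I_n -> topologicalType).
Hypothesis n_gt0 : (0 < n)%N.
Hypothesis X_metrizable : forall i, metrizable R (X i).

(** The last three clauses make [E] the exact discontinuity set; with nonnegativity they also give
    lower semicontinuity everywhere. *)
Definition separately_continuous_bump (E : set (prod_topology X))
    (f : prod_topology X -> R) :=
  [/\ separately_continuous f, forall x, 0 <= f x <= 1,
      forall x, ~ E x -> {for x, continuous f}, forall x, E x -> f x = 0 &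
      forall x U, E x -> nbhs x U -> exists2 z, U z & f z = 1].

Lemma dfwith_dfwith (k : 'I_n) (x : prod_topology X) s t :
  dfwith (dfwith x k s) k t = dfwith x k t.
Proof. by rewrite -insert_omit omit_dfwith insert_omit. Qed.

Lemma dfwith_id (k : 'I_n) (x : prod_topology X) : dfwith x k (x k) = x.
Proof.
by apply: (@prod_eqP _ _ k); [rewrite dfwithin|rewrite omit_dfwith].
Qed.

(* The values on [L] are zero and [L] contains, near each point of [E], the
   lines through it; hence separate continuity at the points of [E]. *)
Lemma separately_continuous_bump_lines (E L : set (prod_topology X)) :
  E `<=` L -> closed E -> closed L -> nowhere_dense L ->
  (forall x k, E x -> \forall t \near x k, L (dfwith x k t)) ->
  exists f, separately_continuous_bump E f.
Proof.
move=> EL cE cL nL lines.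
have [f [f01 fL fC f1]] := closed_bump (metrizable_prod X_metrizable) EL cE cL nL.
exists f; split=> // [k x s|x /EL]; last exact: fL.
pose y : prod_topology X := dfwith x k s.
have -> : (fun t => f (dfwith x k t)) = fun t => f (dfwith y k t).
  by apply/funext => t; rewrite dfwith_dfwith.
have yk : y k = s by rewrite /y dfwithin.
rewrite -yk; have [Ey|nEy] := pselect (E y).
  rewrite /continuous_at dfwith_id (fL _ (EL _ Ey)).
  apply: cvg_near_cst; near=> t; apply: fL; near: t; exact: lines.
have fy : {for dfwith y k (y k), continuous f} by rewrite dfwith_id; exact: fC.
by move=> A /fy; exact: (@dfwith_continuous _ _ y k (y k)).
Unshelve. all: by end_near. Qed.

(** The [M i] are cylinders over closures of nowhere dense sets. The covering is conditional, with
    empty sets as default, so that choice applies to all indices. *)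
Lemma projectively_meagre_cover (k : 'I_n) (A : set (prod_topology X)) :
  exists M : (set (prod_topology X))^nat,
    [/\ forall i, closed (M i), forall i, nowhere_dense (M i),
        forall i x t, M i x -> M i (dfwith x k t) &
        projectively_meagre k A -> A `<=` \bigcup_i M i].
Proof.
have [[F nF AF]|nmA] := pselect (projectively_meagre k A); last first.
  exists (fun=> set0); split=> //.
  - by move=> _; exact: closed0.
  - by move=> _; exact: nowhere_dense0.
exists (fun i => @omit_coord n X k @^-1` closure (F i)); split.
- move=> i; apply: preimage_closed; last exact: closed_closure.
  by move=> x _; exact: omit_coord_continuous.
- by move=> i; apply/nowhere_dense_omit/nowhere_dense_closure.
- by move=> i x t /=; rewrite omit_dfwith.
- move=> _ x Ax; have : (\bigcup_i F i) (omit_coord k x) by rewrite -AF; exists x.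
  by move=> [i _ Fx]; exists i => //; exact: subset_closure.
Qed.

(** Near each point a basic set has projectively meagre trace in every direction; choosing one
    cylinder per direction gives the pieces, and the union of those cylinders gives the set
    containing the lines. *)
Lemma closed_locally_projectively_meagre_bumps (C : set (prod_topology X)) :
  closed C -> locally_projectively_meagre C ->
  exists (E : nat * nat * {ffun 'I_n -> nat} -> set (prod_topology X)),
    (forall p, exists f, separately_continuous_bump (E p) f) /\ C = \bigcup_p E p.
Proof.
move=> cC mC.
have [S [W [cS oW SW dW base]]] := sigma_discrete_base (metrizable_prod X_metrizable).
have /choice[M MP] : forall a : nat * nat * prod_topology X * 'I_n,
    exists M : (set (prod_topology X))^nat,
    [/\ forall i, closed (M i), forall i, nowhere_dense (M i),
        forall i x t, M i x -> M i (dfwith x a.2 t) &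
        projectively_meagre a.2 (C `&` W a.1.1 a.1.2) ->
          C `&` W a.1.1 a.1.2 `<=` \bigcup_i M i].
  by move=> a; exact: projectively_meagre_cover.
pose piece (p : nat * nat * {ffun 'I_n -> nat}) c := C `&` S p.1 c `&`
  \bigcap_(k in [set: 'I_n]) M (p.1, c, k) (p.2 k).
pose cross (p : nat * nat * {ffun 'I_n -> nat}) c := closure (W p.1 c) `&`
  [set x | exists k, M (p.1, c, k) (p.2 k) x].
exists (fun p => \bigcup_c piece p c); split=> [p|].
  have finM c := @closed_nowhere_dense_finite _ _
    (fun k => M (p.1, c, k) (p.2 k)) (fun k => let: And4 h _ _ _ := MP (p.1, c, k) in h _)
    (fun k => let: And4 _ h _ _ := MP (p.1, c, k) in h _).
  have dcross : discrete_family (cross p).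
    by apply: (discrete_family_sub _ (discrete_family_closure (dW p.1))) => c x [].
  apply: (@separately_continuous_bump_lines _ (\bigcup_c cross p c)).
  - move=> x [c _ [[_ Sx] Mx]]; exists c => //; split.
      by apply: subset_closure; exact: SW.
    (* Positivity of [n] supplies a direction whose cylinder contains the point. *)
    by exists (Ordinal n_gt0); exact: Mx.
  - apply: closed_discrete => [|c].
      by apply: (discrete_family_sub _ (dW p.1)) => c x [[_ /SW]].
    apply: closedI; first exact: closedI.
    by apply: closed_bigI => k _; have [] := MP (p.1, c, k).
  - apply: closed_discrete => // c; apply: closedI; first exact: closed_closure.
    exact: (finM c).1.
  - apply: nowhere_dense_discrete => // c.
    by apply: nowhere_dense_sub (finM c).2 => x [].
  - move=> x k [c _ [[_ Sx] Mx]].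
    have xW : nbhs (dfwith x k (x k) : prod_topology X) (W p.1 c).
      by rewrite dfwith_id; apply: open_nbhs_nbhs; split; [exact: oW|exact: SW].
    have : \forall t \near x k, W p.1 c (dfwith x k t).
      exact: (@dfwith_continuous _ _ x k (x k) _ xW).
    apply: filterS => t Wt.
    exists c => //; split; first exact: subset_closure.
    by exists k; have [_ _ /(_ (p.2 k) x t) + _] := MP (p.1, c, k); apply; exact: Mx.
rewrite eqEsubset; split=> x; last by move=> [p _ [c _ [[]]]].
move=> Cx; have /choice[U UP] : forall k, exists U, nbhs x U /\
    projectively_meagre k (C `&` U).
  by move=> k; have [U] := mC k x; exists U.
have xU : \forall y \near x, forall k, U k y.
  by apply: (@filter_forall _ _ U (nbhs x)) => k; have [] := UP k.
have [q [c [Sx WU]]] := base _ _ xU.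
have /choice[i iP] : forall k, exists i, M (q, c, k) i x.
  move=> k; have [_ _ _ /=] := MP (q, c, k).
  have mW : projectively_meagre k (C `&` W q c).
    apply: meagre_sub (UP k).2; apply: image_subset => y [Cy /WU].
    by split.
  by move=> /(_ mW x)[|i _ Mi]; [split=> //; exact: SW|exists i].
exists (q, [ffun k => i k]) => //; exists c => //; split=> // k _.
by rewrite /= ffunE.
Qed.

Lemma bumps_discontinuity_set (E : (set (prod_topology X))^nat) :
  (forall q, exists f, separately_continuous_bump (E q) f) ->
  exists f : prod_topology X -> R,
    separately_continuous f /\ discontinuity_set f = \bigcup_q E q.
Proof.
move=> /choice[f fP]; have f01 q x : 0 <= f q x <= 1 by have [] := fP q.
have [F FP] := partial_sum_limit f01.
exists F; split.
  move=> k x s; apply: (@continuous_limit _ _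
    (fun N t => partial_sum f N (dfwith x k t))) => // N.
  apply: (@partial_sum_continuous _ _ (fun q t => f q (dfwith x k t))) => q.
  by have [+ _ _ _ _] := fP q; exact.
rewrite eqEsubset; split=> x.
  move=> xF; apply: contrapT => nE; apply: xF; apply: (continuous_limit FP) => N.
  apply: partial_sum_continuous => q; have [_ _ + _ _] := fP q; apply.
  by move=> Ex; apply: nE; exists q.
move=> [q _ Ex]; apply: (@partial_sum_limit_discontinuous _ _ f _ _ q FP) => //.
(* On [E p] the term takes its least value 0; elsewhere it is continuous. *)
- move=> p e e0; have [_ _ fC f0 _] := fP p.
  have [Ep|nEp] := pselect (E p x).
    apply: filterE => y; rewrite f0//; have /andP[] := f01 p y; lra.
  have /cvgrPdist_lt/(_ _ e0) := fC _ nEp; apply: filterS => y.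
  by rewrite ltr_norml => /andP[? ?]; lra.
- by have [_ _ _ + _] := fP q; exact.
- by have [_ _ _ _ +] := fP q => fU U; exact: fU.
Qed.

End Construction.

Theorem theorem4p1 (R : realType) (n : nat) (n_gt0 : (0 < n)%N)
    (X : 'I_n -> topologicalType)
    (X_metrizable : forall i, metrizable R (X i))
    (E : set (prod_topology X)) :
  (exists f : prod_topology X -> R,
     separately_continuous f /\ discontinuity_set f = E)
  <->
  (exists Em : (set (prod_topology X))^nat,
     E = \bigcup_m Em m /\
     forall m, Fsigma (Em m) /\ locally_projectively_meagre (Em m)).
Proof.
split=> [[f [sf <-]]|[Em [-> EmP]]].
  exact: discontinuity_set_decomposition.
have /choice[C CP] : forall m, exists C : (set (prod_topology X))^nat,
    (forall i, closed (C i)) /\ Em m = \bigcup_i C i.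
  by move=> m; have [[C cC EC] _] := EmP m; exists C.
have /choice[D DP] : forall mi : nat * nat,
    exists D : nat * nat * {ffun 'I_n -> nat} -> set (prod_topology X),
    (forall p, exists f : prod_topology X -> R, separately_continuous_bump (D p) f) /\
    C mi.1 mi.2 = \bigcup_p D p.
  move=> [m i]; apply: closed_locally_projectively_meagre_bumps => //.
    exact: (CP m).1.
  move=> k; apply: locally_projectively_meagre_sub ((EmP m).2 k).
  by rewrite (CP m).2; exact: bigcup_sup.
pose I := (nat * nat * (nat * nat * {ffun 'I_n -> nat}))%type.
pose G j := if @unpickle I j is Some mip then D mip.1 mip.2 else set0.
rewrite (_ : \bigcup_m Em m = \bigcup_j G j).
  apply: bumps_discontinuity_set => j; rewrite /G; case: unpickle => [[mi p]|].
    exact: (DP mi).1.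
  (* Numbers that code no index give the empty set, with the zero function as bump. *)
  exists (fun=> 0); split=> // [k x|x|x _]; try exact: cst_continuous.
  by rewrite lexx ler01.
rewrite eqEsubset; split=> x.
  move=> [m _]; rewrite (CP m).2 => -[i _]; rewrite -/(C (m, i).1 (m, i).2).
  rewrite (DP (m, i)).2 => -[p _ Dx].
  by exists (pickle (((m, i), p) : I)) => //; rewrite /G pickleK.
move=> [j _]; rewrite /G; case: unpickle => [[[m i] p] Dx|//].
exists m => //; rewrite (CP m).2; exists i => //.
by rewrite -/(C (m, i).1 (m, i).2) (DP (m, i)).2; exists p.
Qed.
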